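(* Let $(A,B)$ be an infinitesimally rigid nonnegative rank-$r$ factorization, with $A\in\mathbb{R}^{m\times r}_{\ge 0}$ and $B\in\mathbb{R}^{r\times n}_{\ge 0}$, such that $A$ and $B$ have $r^2-r+1$ zero entries in total. Let $\alpha,\beta\subseteq[r]=\{1,\dots,r\}$, and suppose that $A$ has a $k\times|\alpha|$ submatrix of zeros with columns $\alpha$, and that $B$ has a $|\beta|\times\ell$ submatrix of zeros with rows $\beta$. Then $$k|\alpha|+\ell|\beta|\le (r-|\alpha|)|\alpha|+(r-|\beta|)|\beta|-|\alpha\setminus\beta|\,|\beta\setminus\alpha|.$$
   Context: Here $m,n,r$ are positive integers, and inequalities between matrices are entrywise. A nonnegative rank-$r$ factorization is a pair $(A,B)$ with $A\in\mathbb{R}^{m\times r}_{\ge 0}$, $B\in\mathbb{R}^{r\times n}_{\ge 0}$ and $\operatorname{rank}(AB)=r$. An infinitesimal motion of $(A,B)$ is a pair $(\dot A,\dot B)\in\mathbb{R}^{m\times r}\times\mathbb{R}^{r\times n}$ with $A\dot B+\dot A B=0$ such that for some $\epsilon>0$ one has $A+t\dot A\ge 0$ and $B+t\dot B\ge 0$ for all $t\in[0,\epsilon)$. The motion is trivial if $\dot A=AD$ and $\dot B=-DB$ for some diagonal $D\in\mathbb{R}^{r\times r}$. The factorization $(A,B)$ is infinitesimally rigid if all of its infinitesimal motions are trivial.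
   Formalization: For r=1 the formal theorem requires k, |α|, ℓ and |β| to be positive; with empty blocks allowed the claim fails there, e.g. A=(1,0)^T, B=(1), α={1}, k=1, β=∅ would give 1 ≤ 0. For r≥2 nothing is changed. *)

(* Defs.v *)
From HB Require Import structures.
From mathcomp Require Import all_boot all_order all_algebra.
From mathcomp Require Import reals.

Set Implicit Arguments.
Unset Strict Implicit.
Unset Printing Implicit Defensive.

Import Order.TTheory GRing.Theory Num.Theory.

Local Open Scope ring_scope.

Definition nonneg_mx (R : realType) (p q : nat) (M : 'M[R]_(p, q)) : Prop :=
  forall i j, 0 <= M i j.

Definition nonneg_factorization (R : realType) (m n r : nat)
    (A : 'M[R]_(m, r)) (B : 'M[R]_(r, n)) : Prop :=
  [/\ nonneg_mx A, nonneg_mx B & \rank (A *m B) = r].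

Definition infinitesimal_motion (R : realType) (m n r : nat)
    (A : 'M[R]_(m, r)) (B : 'M[R]_(r, n))
    (dA : 'M[R]_(m, r)) (dB : 'M[R]_(r, n)) : Prop :=
  A *m dB + dA *m B = 0 /\
  (exists2 eps : R, 0 < eps & forall t : R, 0 <= t -> t < eps ->
     nonneg_mx (A + t *: dA) /\ nonneg_mx (B + t *: dB)).

Definition trivial_motion (R : realType) (m n r : nat)
    (A : 'M[R]_(m, r)) (B : 'M[R]_(r, n))
    (dA : 'M[R]_(m, r)) (dB : 'M[R]_(r, n)) : Prop :=
  exists D : 'M[R]_r, [/\ is_diag_mx D, dA = A *m D & dB = - (D *m B)].

Definition infinitesimally_rigid (R : realType) (m n r : nat)
    (A : 'M[R]_(m, r)) (B : 'M[R]_(r, n)) : Prop :=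
  forall dA dB, infinitesimal_motion A B dA dB -> trivial_motion A B dA dB.

Definition nb_zeros (R : realType) (p q : nat) (M : 'M[R]_(p, q)) : nat :=
  #|[set ij : 'I_p * 'I_q | M ij.1 ij.2 == 0]|.

Definition zero_submx (R : realType) (p q : nat) (M : 'M[R]_(p, q))
    (I : {set 'I_p}) (J : {set 'I_q}) : Prop :=
  forall i j, i \in I -> j \in J -> M i j = 0.

(* Main.v *)
Require Import Defs.
From HB Require Import structures.
From mathcomp Require Import all_boot all_order all_algebra.
From mathcomp Require Import reals.
From mathcomp Require Import zify lra.

(** Since rank (A B) = r, the motions of (A, B) are the pairs (A D, - D B) with
    D an r x r matrix, and only the zero entries of A and B constrain D: each
    zero gives a linear form in D, the velocity of that entry, which has to be
    nonnegative.  Every diagonal D satisfies these constraints with equality,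
    and rigidity says that no other D satisfies them ([rigid_diag]).

    The forms vanish on the diagonal matrices, so they live on a space of
    dimension r^2 - r, and there are r^2 - r + 1 of them.  Consequently any
    proper subfamily is linearly independent: otherwise, for some form outside
    the subfamily, all forms but that one would have a common zero D that is
    nonzero off the diagonal, and D or - D would be a forbidden motion.

    A row of A indexed by K is supported off alpha, and a column of B indexed
    by L is supported off beta.  So the forms attached to the two blocks of
    zeros involve only the coordinates of D in the union of ~alpha x alpha and
    beta x ~beta ([block_support]).  The two rectangles meet in
    (beta \ alpha) x (alpha \ beta), so the cardinality of the union is the
    right-hand side of the inequality ([card_block_support]), and independence
    of the block forms bounds their number by it ([block_le_support]).

    For independence the blocks must not contain all the zeros.  When r >= 2,
    the matrix B always has a zero outside its block
    ([exists_zero_outside_block]); when r = 1 there is a single zero in total,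
    while two nonempty blocks would contain at least two. *)

Set Implicit Arguments.
Unset Strict Implicit.
Unset Printing Implicit Defensive.

Import Order.TTheory GRing.Theory Num.Theory.

Local Open Scope ring_scope.

Definition sum_set (T1 T2 : finType) (P : {set T1}) (Q : {set T2}) :
    {set T1 + T2} :=
  [set x | match x with inl a => a \in P | inr b => b \in Q end].

Lemma card_sum_set (T1 T2 : finType) (P : {set T1}) (Q : {set T2}) :
  #|sum_set P Q| = (#|P| + #|Q|)%N.
Proof.
rewrite -!sum1_card big_sumType /=.
by congr (_ + _)%N; apply: eq_bigl => x; rewrite inE.
Qed.

(** A homogeneous linear system with fewer equations than unknowns: the matrix
    of the system has a nonzero left kernel. *)
Lemma exists_nonzero_solution (F : fieldType) (p q : nat) (I : finType)
    (C : {set I}) (f : I -> 'M[F]_(p, q) -> F) :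
    (forall i, scalar (f i)) -> (#|C| < p * q)%N ->
  exists2 D, D != 0 & forall i, i \in C -> f i D = 0.
Proof.
move=> linf ltC.
pose g (u : 'rV[F]_(p * q)) := \row_(j < #|C|) f (enum_val j) (vec_mx u).
have ling : linear g.
  by move=> a u v; apply/rowP=> j; rewrite !mxE linearP linf.
pose gL : {linear 'rV_(p * q) -> 'rV_#|C|} :=
  HB.pack g (GRing.isLinear.Build _ _ _ _ g ling).
have : kermx (lin1_mx gL) != 0.
  rewrite -mxrank_eq0 mxrank_ker subn_eq0 -ltnNge.
  exact: leq_ltn_trans (rank_leq_col _) ltC.
case/rowV0Pn=> u /sub_kermxP; rewrite mul_rV_lin1 => gu0 u0.
exists (vec_mx u) => [|i iC]; first by rewrite vec_mx_eq0.
by move/rowP/(_ (enum_rank_in iC i)): gu0; rewrite !mxE enum_rankK_in.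
Qed.

(** Turns first-order conditions at the zeros into an actual interval of times:
    an entry a i > 0 decreasing at speed - b i stays nonnegative until
    a i / - b i, and finitely many such times have a positive minimum. *)
Lemma small_perturbation_ge0 (R : realFieldType) (I : finType) (a b : I -> R) :
    (forall i, 0 <= a i) -> (forall i, a i = 0 -> 0 <= b i) ->
  exists2 eps : R, 0 < eps &
    forall t, 0 <= t -> t < eps -> forall i, 0 <= a i + t * b i.
Proof.
move=> a0 b0.
exists (\big[Num.min/1]_(i | b i < 0) (a i / - b i)).
  apply: lt_bigmin => // i bi; rewrite divr_gt0 ?oppr_gt0 // lt_def a0 andbT.
  by apply: contraTneq bi => /b0; rewrite -leNgt.
move=> t t0 teps i; case: (ltP (b i) 0) => bi; last by rewrite addr_ge0 ?mulr_ge0.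
have : t <= a i / - b i.
  by apply: le_trans (ltW teps) _; apply: bigmin_le_cond.
rewrite ler_pdivlMr ?oppr_gt0 // mulrN; lra.
Qed.

Section Motions.

Variables (R : realType) (m n r : nat).
Implicit Types (A : 'M[R]_(m, r)) (B : 'M[R]_(r, n)) (D : 'M[R]_r).

(** The entries of a pair of matrices, treated as a single family so that zeros
    of A and zeros of B need no separate bookkeeping. *)
Definition entry (M : 'M[R]_(m, r)) (N : 'M[R]_(r, n))
    (z : 'I_m * 'I_r + 'I_r * 'I_n) : R :=
  match z with inl ij => M ij.1 ij.2 | inr ij => N ij.1 ij.2 end.

Definition velocity A B D := entry (A *m D) (- (D *m B)).

Definition zeros A B :=
  sum_set [set ij | A ij.1 ij.2 == 0] [set ij | B ij.1 ij.2 == 0].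

Lemma card_zeros A B : #|zeros A B| = (nb_zeros A + nb_zeros B)%N.
Proof. exact: card_sum_set. Qed.

Lemma in_zeros A B z : (z \in zeros A B) = (entry A B z == 0).
Proof. by case: z => ij; rewrite !inE. Qed.

Lemma velocity_scalar A B z : scalar (fun D => velocity A B D z).
Proof.
move=> a D E; case: z => -[i j]; rewrite /velocity /=.
  by rewrite mulmxDr -scalemxAr !mxE.
by rewrite mulmxDl -scalemxAl opprD -scalerN !mxE.
Qed.

(** Rigidity in terms of D alone.  Cancelling A in A D = A D' is possible
    because A has full column rank. *)
Lemma rigid_diag A B D :
    nonneg_factorization A B -> infinitesimally_rigid A B ->
    (forall z, z \in zeros A B -> 0 <= velocity A B D z) ->
  is_diag_mx D.
Proof.
move=> [A0 B0 rkAB] rigid vD.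
have fullA : row_full A.
  by rewrite /row_full eqn_leq rank_leq_col -{1}rkAB mxrankM_maxl.
suff /rigid[D' [diagD' /(row_full_inj fullA)-> _]] :
  infinitesimal_motion A B (A *m D) (- (D *m B)) by [].
split; first by rewrite mulmxN mulmxA addNr.
have [||eps eps0 heps] := @small_perturbation_ge0 R _ (entry A B) (velocity A B D).
- by case=> -[i j] /=; [exact: A0 | exact: B0].
- by move=> z /eqP; rewrite -in_zeros; exact: vD.
exists eps => // t t0 teps; split=> i j.
  by rewrite [leRHS]mxE [X in _ + X]mxE; exact: heps t0 teps (inl (i, j)).
by rewrite [leRHS]mxE [X in _ + X]mxE; exact: heps t0 teps (inr (i, j)).
Qed.

(** If all zeros of B lay in beta x L, an elementary matrix D = E_pq with p <> q
    and not (p in beta, q notin beta) would be a motion.  Indeed A E_pq >= 0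
    because A >= 0, and - E_pq B only alters row p, by the opposite of row q;
    at a zero of B in row p one has p in beta, hence q in beta, so row q also
    vanishes there. *)
Lemma exists_zero_outside_block A B (beta : {set 'I_r}) (L : {set 'I_n}) :
    (1 < r)%N -> nonneg_factorization A B -> infinitesimally_rigid A B ->
    zero_submx B beta L ->
  exists2 ij, B ij.1 ij.2 = 0 & ij \notin setX beta L.
Proof.
move=> r1 fAB rigid hB.
have [[p q] /= pq npq] :
    exists2 pq : 'I_r * 'I_r, pq.1 != pq.2 & ~~ ((pq.1 \in beta) && (pq.2 \notin beta)).
  (* Of (i0, i1) and (i1, i0), at most one leaves beta. *)
  pose i0 : 'I_r := Ordinal (ltnW r1); pose i1 : 'I_r := Ordinal r1.
  have [i0b|i0b] := boolP (i0 \in beta).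
    by exists (i1, i0); rewrite //= i0b andbF.
  by exists (i0, i1); rewrite //= (negPf i0b).
case: (pickP [pred ij : 'I_r * 'I_n | (B ij.1 ij.2 == 0) && (ij \notin setX beta L)]).
  by move=> ij /andP[/eqP]; exists ij.
move=> inblock; exfalso.
have /is_diag_mxP/(_ _ _ pq)/eqP : is_diag_mx (delta_mx p q : 'M[R]_r).
  apply: (rigid_diag fAB rigid) => -[[i j]|[i j]]; rewrite in_zeros /velocity /=.
    case: fAB => A0 _ _ _; rewrite mxE; apply: sumr_ge0 => s _.
    by rewrite mxE mulr_ge0 // ler0n.
  move=> Bij; have := inblock (i, j); rewrite /= Bij /= => /negbFE.
  rewrite in_setX /= => /andP[ib jL].
  rewrite mxE mxE (bigD1 q) //= big1 ?addr0 => [|s /negPf sq]; last first.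
    by rewrite mxE sq andbF mul0r.
  rewrite mxE eqxx andbT; case: eqP => [ip|_]; last by rewrite mul0r oppr0.
  by move: npq; rewrite -ip ib /= negbK => qb; rewrite hB // mulr0 oppr0.
by rewrite mxE !eqxx oner_eq0.
Qed.

(** The coordinates of D seen by the velocities of the entries in the blocks
    K x alpha of A and beta x L of B. *)
Definition block_support (alpha beta : {set 'I_r}) : {set 'I_r * 'I_r} :=
  setX (~: alpha) alpha :|: setX beta (~: beta).

Lemma velocity_block0 A B D (alpha beta : {set 'I_r}) (K : {set 'I_m})
    (L : {set 'I_n}) z :
    zero_submx A K alpha -> zero_submx B beta L ->
    (forall pq, pq \in block_support alpha beta -> D pq.1 pq.2 = 0) ->
    z \in sum_set (setX K alpha) (setX beta L) -> velocity A B D z = 0.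
Proof.
move=> hA hB D0; rewrite /velocity.
case: z => -[i j]; rewrite !inE /= => /andP[hi hj].
  rewrite mxE big1 // => p _; have [pa|pa] := boolP (p \in alpha).
    by rewrite hA // mul0r.
  by rewrite (D0 (p, j)) ?mulr0 // !inE pa hj.
rewrite mxE mxE big1 ?oppr0 // => q _; have [qb|qb] := boolP (q \in beta).
  by rewrite hB // mulr0.
by rewrite (D0 (i, q)) ?mul0r // !inE qb hi orbT.
Qed.

Lemma card_block_support (alpha beta : {set 'I_r}) :
  (#|block_support alpha beta| + #|alpha :\: beta| * #|beta :\: alpha|
    = #|~: alpha| * #|alpha| + #|beta| * #|~: beta|)%N.
Proof.
have cardI : (#|alpha :\: beta| * #|beta :\: alpha|
    = #|setX (~: alpha) alpha :&: setX beta (~: beta)|)%N.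
  rewrite mulnC -cardsX; congr #|pred_of_set _|; apply/setP=> -[p q].
  rewrite !inE /=.
  by case: (p \in alpha) (q \in alpha) (p \in beta) (q \in beta) => [] [] [] [].
rewrite cardsU cardI subnK ?cardsX //.
by rewrite -!cardsX (leq_trans (subset_leq_card (subsetIl _ _))) ?leq_addr.
Qed.

(** If the block had more zeros than support coordinates, consider the system
    requiring that D vanish on the support and on the diagonal, and that the
    velocities of all zeros outside the block vanish, except for one zero z.
    It has fewer than r^2 equations, hence a nonzero solution D.  The only
    velocity of a zero entry that can survive is that of z, so D or - D is a
    motion; it would then be diagonal, hence 0. *)
Lemma block_le_support A B (alpha beta : {set 'I_r}) (K : {set 'I_m})
    (L : {set 'I_n}) :
    (1 < r)%N -> nonneg_factorization A B -> infinitesimally_rigid A B ->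
    (#|zeros A B| <= r ^ 2 - r + 1)%N ->
    zero_submx A K alpha -> zero_submx B beta L ->
  (#|K| * #|alpha| + #|beta| * #|L| <= #|block_support alpha beta|)%N.
Proof.
move=> r1 fAB rigid leN hA hB; rewrite leqNgt; apply/negP=> ltS.
have [ij Bij ijNL] := exists_zero_outside_block r1 fAB rigid hB.
set block := sum_set (setX K alpha) (setX beta L).
have cardb : #|block| = (#|K| * #|alpha| + #|beta| * #|L|)%N.
  by rewrite card_sum_set !cardsX.
pose z : 'I_m * 'I_r + 'I_r * 'I_n := inr ij.
have zZ : z \in zeros A B :\: block.
  by rewrite in_setD in_zeros /= Bij eqxx andbT inE.
have block_zeros : block \subset zeros A B.
  apply/subsetP=> -[] [i j]; rewrite in_zeros inE in_setX /= => /andP[hi hj].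
    by rewrite hA.
  by rewrite hB.
pose diag := [set (i, i) | i : 'I_r].
pose coord := block_support alpha beta :|: diag.
pose rest := (zeros A B :\: block) :\ z.
pose f (x : 'I_r * 'I_r + ('I_m * 'I_r + 'I_r * 'I_n)) (D : 'M[R]_r) :=
  match x with inl pq => D pq.1 pq.2 | inr y => velocity A B D y end.
have linf x : scalar (f x).
  by case: x => [pq|y] a D E; [rewrite /= !mxE | exact: velocity_scalar].
have few : (#|sum_set coord rest| < r * r)%N.
  have cdiag : (#|diag| <= r)%N.
    by rewrite (leq_trans (leq_imset_card _ _)) ?card_ord.
  have ccoord : (#|coord| <= #|block_support alpha beta| + r)%N.
    by rewrite cardsU (leq_trans (leq_subr _ _)) // leq_add2l.
  have crest : (#|rest|.+1 + #|block| <= r ^ 2 - r + 1)%N.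
    apply: leq_trans leN; rewrite -(cardsID block (zeros A B)).
    by rewrite (setIidPr block_zeros) (cardsD1 z (zeros A B :\: block)) zZ addnC.
  rewrite card_sum_set; nia.
have [D D0 solD] := exists_nonzero_solution linf few.
have D_coord pq : pq \in coord -> D pq.1 pq.2 = 0.
  by move=> h; apply: (solD (inl pq)); rewrite inE.
have D_zeros y : y \in zeros A B -> y != z -> velocity A B D y = 0.
  move=> yZ yz; have [yb|yb] := boolP (y \in block).
    apply: (velocity_block0 hA hB) yb => pq pqS.
    by apply: D_coord; rewrite inE pqS.
  by apply: (solD (inr y)); rewrite inE !in_setD yZ yb in_set1 yz.
have diag_eq0 : is_diag_mx D -> False.
  move/is_diag_mxP=> diagD; case/eqP: D0; apply/matrixP=> i j; rewrite mxE.
  have [/val_inj <-|/diagD//] := eqVneq (val i) (val j).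
  by apply: (D_coord (i, i)); rewrite inE imset_f ?orbT.
have [vz|vz] := leP 0 (velocity A B D z).
  apply/diag_eq0/(rigid_diag fAB rigid) => y yZ.
  by have [->|yz] := eqVneq y z; rewrite // D_zeros.
apply: diag_eq0; rewrite -[D]opprK.
have velN y : velocity A B (- D) y = - velocity A B D y.
  by case: y => ?; rewrite /velocity /= ?mulmxN ?mulNmx [LHS]mxE.
suff /is_diag_mxP diagND : is_diag_mx (- D).
  by apply/is_diag_mxP=> i j ij'; rewrite [LHS]mxE diagND ?oppr0.
apply/(rigid_diag fAB rigid) => y yZ; rewrite velN.
by have [->|yz] := eqVneq y z; [rewrite oppr_ge0 ltW | rewrite D_zeros // oppr0].
Qed.

End Motions.


(* The inequality is stated in [int], so its subtractions are not truncated.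
   Empty blocks (k, l, alpha or beta empty) are allowed when r >= 2.  For r = 1
   they would make the claim false: take A = (1, 0)^T, B = (1), alpha = {1},
   k = 1, beta = empty; so [hne] asks for nonempty blocks when r = 1. *)
Theorem lemma3p10 (R : realType) (m n r : nat)
    (hm : (0 < m)%N) (hn : (0 < n)%N) (hr : (0 < r)%N)
    (A : 'M[R]_(m, r)) (B : 'M[R]_(r, n))
    (hAB : nonneg_factorization A B)
    (hrigid : infinitesimally_rigid A B)
    (hzeros : (nb_zeros A + nb_zeros B = r ^ 2 - r + 1)%N)
    (alpha beta : {set 'I_r}) (k l : nat)
    (K : {set 'I_m}) (hk : #|K| = k) (hA : zero_submx A K alpha)
    (L : {set 'I_n}) (hl : #|L| = l) (hB : zero_submx B beta L)
    (hne : r = 1%N ->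
       [/\ (0 < k)%N, (0 < #|alpha|)%N, (0 < l)%N & (0 < #|beta|)%N]) :
  k%:Z * #|alpha|%:Z + l%:Z * #|beta|%:Z
    <= (r%:Z - #|alpha|%:Z) * #|alpha|%:Z + (r%:Z - #|beta|%:Z) * #|beta|%:Z
       - #|alpha :\: beta|%:Z * #|beta :\: alpha|%:Z.
Proof.
have Zsub : (#|K| * #|alpha| + #|beta| * #|L| <= nb_zeros A + nb_zeros B)%N.
  rewrite -card_zeros -!cardsX -card_sum_set; apply: subset_leq_card.
  apply/subsetP=> -[] [i j]; rewrite in_zeros inE in_setX /= => /andP[hi hj].
    by rewrite hA.
  by rewrite hB.
have bound : (k * #|alpha| + l * #|beta| <= #|block_support alpha beta|)%N.
  have [r1|r1] := leqP r 1.
    have r_eq1 : r = 1%N by lia.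
    have one_zero : (r ^ 2 - r + 1 = 1)%N by rewrite r_eq1.
    by have [] := hne r_eq1; nia.
  rewrite -hk -hl [X in (_ + X <= _)%N]mulnC.
  by apply: (block_le_support r1 hAB hrigid); rewrite ?card_zeros ?hzeros.
have cU := card_block_support alpha beta.
have := cardsC alpha; have := cardsC beta; rewrite !card_ord => cb ca.
have -> : r%:Z - #|alpha|%:Z = #|~: alpha|%:Z by lia.
have -> : r%:Z - #|beta|%:Z = #|~: beta|%:Z by lia.
nia.
Qed.
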